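(* Let $X_1,X_2,\ldots$ be i.i.d. bivariate Gaussian random vectors $X_i=(X_i^{(1)},X_i^{(2)})$ with mean $0$ and invertible covariance matrix $\Sigma$, let $\sigma^{(j)}>0$ be the standard deviation of $X_1^{(j)}$ ($j=1,2$), and let $\rho\in(-1,1)$ be the correlation coefficient of $X_1^{(1)}$ and $X_1^{(2)}$. Let $\bar X_n=(\max_{1\le i\le n}X_i^{(1)},\max_{1\le i\le n}X_i^{(2)})$ and $a_n=\sqrt{\log n}$. Let $u=(u^{(1)},u^{(2)})\in\mathbb{R}^2$ satisfy $u^{(j)}>\sqrt2\,\sigma^{(j)}$ for $j=1,2$, and put $u/\sigma:=(u^{(1)}/\sigma^{(1)},u^{(2)}/\sigma^{(2)})$. Then $$\lim_{n\to\infty}\frac{1}{a_n^2}\log\mathbb{P}(\bar X_n>a_nu)=J(u/\sigma),$$ where, for $v=(v^{(1)},v^{(2)})$, $$J(v)=\begin{cases}1-\tfrac12(v^{(1)})^2&\text{when }v^{(2)}\le\rho v^{(1)},\\ 1-\tfrac12(v^{(2)})^2&\text{when }v^{(1)}\le\rho v^{(2)},\\ \max\Big\{2-\tfrac12\|v\|_2^2,\ 1-\dfrac{(v^{(1)})^2-2\rho v^{(1)}v^{(2)}+(v^{(2)})^2}{2(1-\rho^2)}\Big\}&\text{otherwise.}\end{cases}$$ Further, let $(I^\star,J^\star)$ be the indices in $\{1,\ldots,n\}$ that attain the component-wise maxima, i.e. $\bar X_n=(X^{(1)}_{I^\star},X^{(2)}_{J^\star})$. Then $$\lim_{n\to\infty}\mathbb{P}\big(I^\star\ne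 J^\star\mid\bar X_n>a_nu\big)=\begin{cases}1&\text{when }2-\tfrac12\|u/\sigma\|_2^2>J_1(u/\sigma),\\0&\text{when }2-\tfrac12\|u/\sigma\|_2^2<J_1(u/\sigma),\end{cases}$$ where $J_1(u/\sigma):=1-\tfrac12\operatorname{ess\,inf}_{x>u}x^T\Sigma^{-1}x$.
   Context: All vector inequalities are component-wise: $x>y$ means $x^{(j)}>y^{(j)}$ for every component $j$. $\|v\|_2^2=(v^{(1)})^2+(v^{(2)})^2$. The essential infimum over $\{x\in\mathbb{R}^2:x>u\}$ is with respect to Lebesgue measure. The maximizing indices $I^\star,J^\star$ (which depend on $n$) are almost surely unique. *)

(* Defs.v *)
From HB Require Import structures.
From mathcomp Require Import all_boot all_order all_algebra.
From mathcomp Require Import all_classical all_reals all_analysis.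
From mathcomp Require Import ess_sup_inf.

Set Implicit Arguments.
Unset Strict Implicit.
Unset Printing Implicit Defensive.

Import Order.TTheory GRing.Theory Num.Theory.
Import numFieldNormedType.Exports.

Local Open Scope classical_set_scope.
Local Open Scope ring_scope.

(* Points of the plane are pairs [x : R * R], so that the library's product
   sigma-algebra and product Lebesgue measure apply; [colvec] is used for
   matrix expressions only. *)
Section plane.
Context {R : realType}.
Implicit Types (x y u v m : R * R) (S : 'M[R]_2).

Definition vgt x y : bool := (y.1 < x.1) && (y.2 < x.2).

Definition colvec x : 'cV[R]_2 := \col_i (if i == ord0 then x.1 else x.2).

Definition sqnorm2 x : R := x.1 ^+ 2 + x.2 ^+ 2.

(* c^T S^-1 c *)
Definition inv_quad_form S (c : 'cV[R]_2) : R :=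
  (c^T *m invmx S *m c) ord0 ord0.

Definition lebesgue2 := ((@lebesgue_measure R) \x (@lebesgue_measure R))%E.

Definition gaussian2_pdf m S x : R :=
  expR (- (inv_quad_form S (colvec x - colvec m) / 2)) /
  (2 * pi * Num.sqrt (\det S)).

(* Essential infimum over the subset D of the plane: extending f by +oo off D
   leaves only the almost-everywhere lower bounds on D. *)
Definition ess_inf_on (D : set (R * R)) (f : R * R -> R) : \bar R :=
  ess_inf lebesgue2 (patch (fun=> +oo%E) D (EFin \o f)).

(* 1 - (1/2) ess inf_{x > u} x^T S^-1 x *)
Definition J1 S u : \bar R :=
  (1%:E - (2^-1)%:E *
     ess_inf_on [set x | vgt x u] (fun x => inv_quad_form S (colvec x)))%E.

(* The first two conditions exclude each other when v > 0 and rho < 1, so the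
   order of the tests is immaterial there. *)
Definition Jrate (rho : R) v : R :=
  if v.2 <= rho * v.1 then 1 - v.1 ^+ 2 / 2
  else if v.1 <= rho * v.2 then 1 - v.2 ^+ 2 / 2
  else Num.max (2 - sqnorm2 v / 2)
         (1 - (v.1 ^+ 2 - 2 * rho * v.1 * v.2 + v.2 ^+ 2)
              / (2 * (1 - rho ^+ 2))).

Definition a_ (n : nat) : R := Num.sqrt (ln n%:R).

(* The maximum of Y 0, ..., Y (n - 1), for n > 0. *)
Definition max_upto (Y : nat -> R) (n : nat) : R :=
  \big[Num.max/Y 0%N]_(i < n) Y i.

Definition attains_max (Y : nat -> R) (n i : nat) : Prop :=
  (i < n)%N /\ Y i = max_upto Y n.

End plane.

Section random_vectors.
Context {d : measure_display} {T : measurableType d} {R : realType}.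
Variable P : probability T R.

Definition stdev (Y : T -> R) : R := Num.sqrt (fine 'V_P[Y]).

Definition correlation (Y Z : T -> R) : R :=
  fine (covariance P Y Z) / (stdev Y * stdev Z).

Definition meanvec (X : T -> R * R) : R * R :=
  (fine 'E_P[fst \o X], fine 'E_P[snd \o X]).

Definition covmx (X : T -> R * R) : 'M[R]_2 :=
  \matrix_(i, j) fine (covariance P (fun w => colvec (X w) i ord0)
                                    (fun w => colvec (X w) j ord0)).

(* A Gaussian vector with invertible covariance matrix, through its density
   with respect to the Lebesgue measure of the plane. *)
Definition nondegenerate_gaussian2 (X : {RV P >-> (R * R)%type}) : Prop :=
  covmx X \in unitmx /\
  forall A : set (R * R), measurable A ->
    distribution P X A =
      (\int[lebesgue2]_(x in A) (gaussian2_pdf (meanvec X) (covmx X) x)%:E)%E.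

Definition mutually_independent (X : nat -> {RV P >-> (R * R)%type}) : Prop :=
  forall (s : seq nat) (B : nat -> set (R * R)),
    uniq s -> (forall i, measurable (B i)) ->
    P (\bigcap_(i in [set` s]) (X i @^-1` B i)) =
      (\prod_(i <- s) P (X i @^-1` B i))%E.

Definition identically_distributed
    (X : nat -> {RV P >-> (R * R)%type}) : Prop :=
  forall i (A : set (R * R)), measurable A ->
    distribution P (X i) A = distribution P (X 0%N) A.

Definition cond_prob (A B : set T) : R := fine (P (A `&` B)) / fine (P B).

(* The component-wise maximum of X 0, ..., X (n - 1), for n > 0. *)
Definition Xbar (X : nat -> T -> R * R) (n : nat) (w : T) : R * R :=
  (max_upto (fun i => (X i w).1) n, max_upto (fun i => (X i w).2) n).

Definition exceedance (X : nat -> T -> R * R) (u : R * R) (n : nat) : set T :=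
  [set w | vgt (Xbar X n w) (a_ n * u.1, a_ n * u.2)].

End random_vectors.

(* Main.v *)
Require Import Defs.
From HB Require Import structures.
From mathcomp Require Import all_boot all_order all_algebra.
From mathcomp Require Import all_classical all_reals all_analysis.
From mathcomp Require Import ring lra zify ess_sup_inf measurable_realfun.

Set Implicit Arguments.
Unset Strict Implicit.
Unset Printing Implicit Defensive.

Import Order.TTheory GRing.Theory Num.Theory.
Import numFieldNormedType.Exports.

Local Open Scope classical_set_scope.
Local Open Scope ring_scope.

(** Write X for X_1, q1, q2, q for the infima of x^T Sigma^-1 x over {x1 > u1},
    {x2 > u2}, {x > u}, and p1, p2, p for the probabilities that X lies in
    a_n times these sets.  Crude Laplace bounds give p1 = n^(- q1 / 2 + o(1)),
    and likewise for p2 and p; here q1 = (u1 / sigma1)^2 > 2, q2 > 2, q > 2.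
    A union bound over pairs of indices yields
      P(Xbar > a_n u) <= n p + (n p1) (n p2),
    where the first term covers exceedances by a common index and the second
    those by distinct indices.  Up to constants both terms are also lower bounds:
    the first because n p -> 0, the second by looking for the two exceedances
    in disjoint halves of {1, ..., n}.  Comparing the exponents of the two terms
    gives both the rate and the conditional limits. *)

(** * The minimum of the standardized quadratic form over an orthant *)

Section quadratic_rate.
Context {R : realType}.
Implicit Types (rho : R) (v x y : R * R).

(** The squared Mahalanobis norm of [y] for unit variances and correlation [rho]. *)
Definition mahal rho y : R :=
  (y.1 ^+ 2 - 2 * rho * y.1 * y.2 + y.2 ^+ 2) / (1 - rho ^+ 2).

(** If the free minimizer of one coordinate, [rho] times the other, is admissible, only the other
    constraint is active; otherwise the minimum over the orthant above [v] sits at the vertex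
    [v]. *)
Definition mahal_argmin rho v : R * R :=
  if v.2 <= rho * v.1 then (v.1, rho * v.1)
  else if v.1 <= rho * v.2 then (rho * v.2, v.2) else v.

(** The gap, multiplied by [1 - rho ^+ 2], is the square [(y.2 - rho * y.1) ^+ 2]. *)
Lemma mahal_ge1 rho y : rho ^+ 2 < 1 -> y.1 ^+ 2 <= mahal rho y.
Proof.
move=> rho1; rewrite /mahal ler_pdivlMr ?subr_gt0//.
by have := sqr_ge0 (y.2 - rho * y.1); nra.
Qed.

Lemma mahal_ge2 rho y : rho ^+ 2 < 1 -> y.2 ^+ 2 <= mahal rho y.
Proof.
move=> rho1; rewrite /mahal ler_pdivlMr ?subr_gt0//.
by have := sqr_ge0 (y.1 - rho * y.2); nra.
Qed.

Lemma mahal_axis1 rho (t : R) : rho ^+ 2 < 1 -> mahal rho (t, rho * t) = t ^+ 2.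
Proof. by move=> rho1; rewrite /mahal/=; field; rewrite subr_eq0 gt_eqF. Qed.

Lemma mahal_axis2 rho (t : R) : rho ^+ 2 < 1 -> mahal rho (rho * t, t) = t ^+ 2.
Proof. by move=> rho1; rewrite /mahal/=; field; rewrite subr_eq0 gt_eqF. Qed.

Lemma mahal_argmin_ge rho v :
  v.1 <= (mahal_argmin rho v).1 /\ v.2 <= (mahal_argmin rho v).2.
Proof. by rewrite /mahal_argmin; case: ifPn => //= _; case: ifPn. Qed.

(** On the first two branches the bound by a single squared coordinate suffices. At the vertex the
    reason is convexity: both partial derivatives are positive there. *)
Lemma mahal_argminP rho v y : rho ^+ 2 < 1 -> 0 <= v.1 -> 0 <= v.2 ->
  v.1 <= y.1 -> v.2 <= y.2 -> mahal rho (mahal_argmin rho v) <= mahal rho y.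
Proof.
move=> rho1 v1 v2 vy1 vy2; rewrite /mahal_argmin.
case: ifPn => [_|].
  rewrite mahal_axis1// (le_trans _ (mahal_ge1 _ _))//.
  by rewrite ler_sqr ?nnegrE// (le_trans v1).
rewrite -ltNge => c1.
case: ifPn => [_|].
  rewrite mahal_axis2// (le_trans _ (mahal_ge2 _ _))//.
  by rewrite ler_sqr ?nnegrE// (le_trans v2).
rewrite -ltNge => c2.
rewrite /mahal ler_pM2r ?invr_gt0 ?subr_gt0//.
(* The numerator is expanded around [v]: [h1] and [h2] sign the linear terms, while [h3] and [h4]
   are the second-order term after completing the square. *)
have h1 : 0 <= (y.1 - v.1) * (v.1 - rho * v.2).
  by rewrite mulr_ge0 ?subr_ge0// ltW.
have h2 : 0 <= (y.2 - v.2) * (v.2 - rho * v.1).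
  by rewrite mulr_ge0 ?subr_ge0// ltW.
have h3 := sqr_ge0 (y.1 - v.1 - rho * (y.2 - v.2)).
have h4 : 0 <= (y.2 - v.2) ^+ 2 * (1 - rho ^+ 2).
  by rewrite mulr_ge0 ?sqr_ge0// subr_ge0 ltW.
rewrite -subr_ge0.
have -> : y.1 ^+ 2 - 2 * rho * y.1 * y.2 + y.2 ^+ 2 -
    (v.1 ^+ 2 - 2 * rho * v.1 * v.2 + v.2 ^+ 2) =
  2 * ((y.1 - v.1) * (v.1 - rho * v.2)) +
  2 * ((y.2 - v.2) * (v.2 - rho * v.1)) +
  (y.1 - v.1 - rho * (y.2 - v.2)) ^+ 2 + (y.2 - v.2) ^+ 2 * (1 - rho ^+ 2) by ring.
lra.
Qed.

(** On a branch with one active constraint the second term wins the maximum, because the square of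
    the other coordinate is at least 2. *)
Lemma JrateE rho v : rho ^+ 2 < 1 -> 2 <= v.1 ^+ 2 -> 2 <= v.2 ^+ 2 ->
  Jrate rho v =
  Num.max (2 - sqnorm2 v / 2) (1 - mahal rho (mahal_argmin rho v) / 2).
Proof.
move=> rho1 v1 v2; rewrite /Jrate /mahal_argmin.
case: ifPn => _; first by rewrite mahal_axis1// max_r// /sqnorm2; lra.
case: ifPn => _; first by rewrite mahal_axis2// max_r// /sqnorm2; lra.
congr Num.max; rewrite /mahal; field.
by rewrite subr_eq0 gt_eqF.
Qed.

End quadratic_rate.

(** * Logarithmic rates in the scale [a_n ^ 2 = ln n] *)

Section log_rate.
Context {R : realType}.
Implicit Types (p q f g : nat -> R) (r s : R).

(** This encodes [p n = n ^ (r + o(1))]. Positivity is a separate clause because [ln] takes the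
    default value 0 at nonpositive arguments. *)
Definition log_rate p r : Prop :=
  (\forall n \near \oo, 0 < p n) /\
  ((@a_ R n) ^+ 2)^-1 * ln (p n) @[n --> \oo] --> r.

Lemma sqr_a_ n : (0 < n)%N -> (@a_ R n) ^+ 2 = ln n%:R.
Proof. by move=> n0; rewrite sqr_sqrtr// ln_ge0// ler1n. Qed.

Lemma cvg_sqr_a_ : (@a_ R n) ^+ 2 @[n --> \oo] --> +oo.
Proof.
apply/cvgryPge => A.
have /cvgryPge/(_ (expR A)) := @cvgr_idn R; apply: filterS2 (nbhs_infty_gt 0).
move=> n n0 An; rewrite sqr_a_// -(expRK A) ler_ln// posrE ?expR_gt0//.
by rewrite ltr0n.
Qed.

Lemma cvg_inv_sqr_a_ : ((@a_ R n) ^+ 2)^-1 @[n --> \oo] --> (0 : R).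
Proof.
apply/gtr0_cvgV0; last exact: cvg_sqr_a_.
by have /cvgryPgt/(_ 0) := cvg_sqr_a_.
Qed.

Lemma near_a_gt0 : \forall n \near \oo, 0 < (@a_ R n).
Proof.
have /cvgryPgt/(_ 0) := cvg_sqr_a_; apply: filterS => n.
rewrite exprn_even_gt0//= => a0.
by rewrite lt_neqAle eq_sym a0 sqrtr_ge0.
Qed.

Lemma log_rate_cst (c : R) : 0 < c -> log_rate (fun=> c) 0.
Proof.
move=> c0; split; first exact: nearW.
rewrite -[X in _ --> X](mul0r (ln c)); apply: cvgMl; exact: cvg_inv_sqr_a_.
Qed.

Lemma log_rate_nat : log_rate (fun n => n%:R) 1.
Proof.
split; first by near=> n; rewrite ltr0n; near: n; exact: nbhs_infty_gt.
apply: cvg_near_cst; have /cvgryPgt/(_ 0) := cvg_sqr_a_.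
apply: filterS2 (nbhs_infty_gt 0) => n n0 a0.
by rewrite -sqr_a_// mulVf// gt_eqF.
Unshelve. all: by end_near. Qed.

Lemma log_rateM p q r s :
  log_rate p r -> log_rate q s -> log_rate (fun n => p n * q n) (r + s).
Proof.
move=> [p0 pr] [q0 qs]; split; first by near=> n; rewrite mulr_gt0//; near: n.
apply: cvg_trans (cvgD pr qs); apply: near_eq_cvg.
near=> n; rewrite lnM ?posrE; [by rewrite mulrDr| |]; by near: n.
Unshelve. all: by end_near. Qed.

Lemma log_rateV p r : log_rate p r -> log_rate (fun n => (p n)^-1) (- r).
Proof.
move=> [p0 pr]; split; first by near=> n; rewrite invr_gt0//; near: n.
apply: cvg_trans (cvgN pr); apply: near_eq_cvg.
near=> n; rewrite lnV ?posrE; [by rewrite mulrN|]; by near: n.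
Unshelve. all: by end_near. Qed.

Lemma log_rate_squeeze f g p r : log_rate f r -> log_rate g r ->
  (\forall n \near \oo, f n <= p n <= g n) -> log_rate p r.
Proof.
move=> [f0 fr] [g0 gr] fpg.
have p0 : \forall n \near \oo, 0 < p n.
  by apply: filterS2 f0 fpg => n f0 /andP[+ _]; exact: lt_le_trans.
split=> //; apply: (squeeze_cvgr _ fr gr); near=> n.
have /andP[fp pg] : f n <= p n <= g n by near: n.
have f0n : 0 < f n by near: n.
have p0n : 0 < p n by near: n.
have g0n : 0 < g n by near: n.
by rewrite !ler_wpM2l ?ler_ln ?posrE ?invr_ge0 ?sqr_ge0.
Unshelve. all: by end_near. Qed.

Lemma log_rate_max p q r s : log_rate p r -> log_rate q s ->
  log_rate (fun n => Num.max (p n) (q n)) (Num.max r s).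
Proof.
move=> [p0 pr] [q0 qs]; split.
  by apply: filterS p0 => n p0; rewrite lt_max p0.
have H : Num.max (((@a_ R n) ^+ 2)^-1 * ln (p n)) (((@a_ R n) ^+ 2)^-1 * ln (q n))
    @[n --> \oo] --> Num.max r s.
  under eq_fun do rewrite maxr_absE.
  rewrite maxr_absE; apply: cvgM; last exact: cvg_cst.
  by apply: cvgD; [exact: cvgD|apply: cvg_norm; exact: cvgB].
apply: cvg_trans H; apply: near_eq_cvg; near=> n.
have p0n : 0 < p n by near: n.
have q0n : 0 < q n by near: n.
rewrite -maxr_pMr ?invr_ge0 ?sqr_ge0//; congr (_ * _).
case: (leP (p n) (q n)) => pq.
  by rewrite max_r// ler_ln.
by rewrite max_l// ler_ln// ltW.
Unshelve. all: by end_near. Qed.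

(** The sum lies between the maximum and twice the maximum, and a constant factor has rate 0. *)
Lemma log_rateD p q r s : log_rate p r -> log_rate q s ->
  log_rate (fun n => p n + q n) (Num.max r s).
Proof.
move=> pr qs; have m := log_rate_max pr qs.
have := log_rateM (@log_rate_cst 2 _) m; rewrite ltr0n add0r => /(_ isT) m2.
apply: (log_rate_squeeze m m2).
case: pr qs => p0 _ [q0 _]; apply: filterS2 p0 q0 => n p0 q0.
by rewrite /=; apply/andP; split; case: (leP (p n)) => /= ?; lra.
Qed.

(** Giving up half of the negative rate absorbs the error term: eventually
    [p n <= expR (r / 2 * a_ n ^+ 2)]. *)
Lemma log_rate_lt0_cvg0 p r : log_rate p r -> r < 0 -> p n @[n --> \oo] --> 0.
Proof.
move=> [p0 pr] r0.
have : expR (- (- r / 2 * (@a_ R n) ^+ 2)) @[n --> \oo] --> 0.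
  have H : - r / 2 * (@a_ R n) ^+ 2 @[n --> \oo] --> +oo.
    have r20 : 0 < - r / 2 by lra.
    apply/cvgryPge => A; have /cvgryPge/(_ (A / (- r / 2))) := cvg_sqr_a_.
    by apply: filterS => n; rewrite ler_pdivrMr// mulrC.
  exact: cvg_comp H (@cvgr_expR R).
move=> e0; apply: (squeeze_cvgr _ (cvg_cst 0) e0).
have h : \forall n \near \oo, ((@a_ R n) ^+ 2)^-1 * ln (p n) < r / 2.
  by move/cvgr_lt : pr; apply; lra.
near=> n.
have p0n : 0 < p n by near: n.
have a0n : 0 < (@a_ R n) by near: n; exact: near_a_gt0.
rewrite (ltW p0n)/= -[leLHS]lnK ?posrE// ler_expR.
have : ((@a_ R n) ^+ 2)^-1 * ln (p n) < r / 2 by near: n.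
rewrite mulrC ltr_pdivrMr ?exprn_gt0//; lra.
Unshelve. all: by end_near. Qed.

(** The constants may depend on [e]: their logarithms vanish after division by [a_ n ^+ 2]. Half of
    the tolerance goes to the exponent and half to them. *)
Lemma log_rate_sandwich p r :
  (forall e, 0 < e -> exists k K, [/\ 0 < k, 0 < K &
     \forall n \near \oo, k * expR ((@a_ R n) ^+ 2 * (r - e)) <= p n
       <= K * expR ((@a_ R n) ^+ 2 * (r + e))]) -> log_rate p r.
Proof.
move=> H; split.
  have [k [K [k0 K0]]] := H _ ltr01; apply: filterS => n /andP[+ _].
  by apply: lt_le_trans; rewrite mulr_gt0 ?expR_gt0.
apply/cvgrPdist_le => e e0.
have e20 : 0 < e / 2 by lra.
have [k [K [k0 K0 b]]] := H _ e20.
have small c : 0 < c -> \forall n \near \oo, `|((@a_ R n) ^+ 2)^-1 * ln c| <= e / 2.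
  move=> /log_rate_cst[_] /cvgrPdist_le /(_ _ e20).
  by apply: filterS => n; rewrite sub0r normrN.
have sk := small _ k0; have sK := small _ K0.
near=> n.
have a0n : 0 < (@a_ R n) by near: n; exact: near_a_gt0.
have /andP[b1 b2] : k * expR ((@a_ R n) ^+ 2 * (r - e / 2)) <= p n
       <= K * expR ((@a_ R n) ^+ 2 * (r + e / 2)) by near: n.
have : `|((@a_ R n) ^+ 2)^-1 * ln k| <= e / 2 by near: n.
have : `|((@a_ R n) ^+ 2)^-1 * ln K| <= e / 2 by near: n.
rewrite !ler_norml => /andP[_ K2] /andP[k1 _].
set A := (@a_ R n) ^+ 2 in b1 b2 K2 k1 *.
have A0 : 0 < A by rewrite exprn_gt0.
have kp : 0 < k * expR (A * (r - e / 2)) by rewrite mulr_gt0 ?expR_gt0.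
have pp := lt_le_trans kp b1.
have Kp := lt_le_trans pp b2.
move: b1; rewrite -ler_ln ?posrE// lnM ?posrE ?expR_gt0// expRK => b1.
move: b2; rewrite -ler_ln ?posrE// lnM ?posrE ?expR_gt0// expRK => b2.
have h1 : A^-1 * (ln k + A * (r - e / 2)) <= A^-1 * ln (p n).
  by rewrite ler_pM2l ?invr_gt0.
have h2 : A^-1 * ln (p n) <= A^-1 * (ln K + A * (r + e / 2)).
  by rewrite ler_pM2l ?invr_gt0.
move: h1 h2; rewrite !(mulrDr A^-1) !mulKf ?gt_eqF// => h1 h2.
by apply/andP; split; lra.
Unshelve. all: by end_near. Qed.

End log_rate.

(** * Laplace bounds for Gaussian integrals *)

Section plane_integrals.
Context {R : realType}.
Implicit Types (x y : R * R) (A : set (R * R)).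

Lemma integral_expRNsqr_fin (e : R) : 0 < e -> exists2 K : R, 0 < K &
  (\int[lebesgue_measure]_t (expR (- (e * t ^+ 2)))%:E = K%:E)%E.
Proof.
(* With variance [s ^+ 2 = (2 * e)^-1] the integrand is a normal density divided by its peak
   value. *)
move=> e0; pose s := Num.sqrt (2 * e)^-1.
have s20 : 0 < (2 * e)^-1 by rewrite invr_gt0 mulr_gt0.
have s0 : s != 0 by rewrite gt_eqF// sqrtr_gt0.
have s2 : s ^+ 2 = (2 * e)^-1 by rewrite sqr_sqrtr// ltW.
exists (normal_peak s)^-1; first by rewrite invr_gt0 normal_peak_gt0.
have E t : expR (- (e * t ^+ 2)) = (normal_peak s)^-1 * normal_pdf 0 s t.
  rewrite normal_pdfE// mulKf ?gt_eqF ?normal_peak_gt0//.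
  rewrite /normal_fun subr0 s2; congr expR; field; lra.
under eq_integral do rewrite E EFinM.
rewrite ge0_integralZl//=.
- by rewrite integral_normal_pdf mule1.
- apply/measurable_EFinP; exact: measurable_normal_pdf.
- by move=> t _; rewrite lee_fin normal_pdf_ge0.
- by rewrite lee_fin invr_ge0 normal_peak_ge0.
Qed.

Lemma integral_expRN_sqnorm_fin (a b : R) : 0 < a -> 0 < b ->
  exists2 K : R, 0 < K &
  (\int[lebesgue2]_x (expR (- (a * x.1 ^+ 2 + b * x.2 ^+ 2)))%:E = K%:E)%E.
Proof.
move=> a0 b0.
have [K K0 KE] := integral_expRNsqr_fin a0.
have [L L0 LE] := integral_expRNsqr_fin b0.
exists (L * K); first exact: mulr_gt0.
rewrite /lebesgue2 fubini_tonelli1//=; last first.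
  apply/measurable_EFinP; apply: measurableT_comp => //.
  apply: measurable_funN; apply: measurable_funD; apply: measurable_funM => //;
    exact/measurable_funX.
rewrite /fubini_F/=.
have E t : (\int[lebesgue_measure]_z (expR (- (a * t ^+ 2 + b * z ^+ 2)))%:E
   = L%:E * (expR (- (a * t ^+ 2)))%:E)%E.
  rewrite -LE muleC -ge0_integralZl//=.
  - by apply: eq_integral => z _; rewrite -EFinM -expRD opprD.
  - apply/measurable_EFinP; apply: measurableT_comp => //.
    by apply: measurable_funN; apply: measurable_funM => //; exact/measurable_funX.
under eq_integral do rewrite E.
rewrite ge0_integralZl//=.
- by rewrite KE.
- apply/measurable_EFinP; apply: measurableT_comp => //.
  by apply: measurable_funN; apply: measurable_funM => //; exact/measurable_funX.
- by rewrite lee_fin ltW.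
Qed.

Lemma lebesgue2_rect (a b c e : R) : a <= b -> c <= e ->
  lebesgue2 (`]a, b[ `*` `]c, e[) = ((b - a) * (e - c))%:E.
Proof.
move=> ab ce; rewrite /lebesgue2 product_measure1E//=.
rewrite !lebesgue_measure_itv/= !lte_fin.
case: ltgtP ab => [ab|//|->] _; case: ltgtP ce => [ce|//|->] _;
 by rewrite ?subrr ?mulr0 ?mul0r ?mule0 ?mul0e // -EFinB -EFinB -EFinM.
Qed.

End plane_integrals.

Section gaussian_form.
Context {R : realType}.
Variables (rho : R) (s : R * R).
Hypotheses (rho1 : rho ^+ 2 < 1) (s1_gt0 : 0 < s.1) (s2_gt0 : 0 < s.2).
Implicit Types (x y : R * R) (A : set (R * R)).

(** The form [x^T Sigma^-1 x] for standard deviations [s] and correlation [rho], in standardized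
    coordinates. *)
Definition gform x : R := mahal rho (x.1 / s.1, x.2 / s.2).

Lemma gform_scale (a : R) x : gform (a * x.1, a * x.2) = a ^+ 2 * gform x.
Proof. by rewrite /gform /mahal/= -!(mulrA a); ring. Qed.

(** The mean of the two coordinate bounds. It makes the form coercive, so that a small fraction of
    it already secures integrability. *)
Lemma gform_ge_sqr x : (s.1 ^- 2 * x.1 ^+ 2 + s.2 ^- 2 * x.2 ^+ 2) / 2 <= gform x.
Proof.
have h1 := mahal_ge1 (x.1 / s.1, x.2 / s.2) rho1.
have h2 := mahal_ge2 (x.1 / s.1, x.2 / s.2) rho1.
rewrite /gform; move: h1 h2; rewrite /= !expr_div_n.
by rewrite !(mulrC (_ ^- 2)); lra.
Qed.

Lemma continuous_gform : continuous gform.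
Proof.
have f1 : continuous (@fst R R) by move=> x; exact: cvg_fst.
have f2 : continuous (@snd R R) by move=> x; exact: cvg_snd.
move=> x; rewrite /gform /mahal/=.
have c1 : (fun y : R * R => y.1 / s.1) y @[y --> x] --> x.1 / s.1.
  by apply: cvgM; [exact: f1|exact: cvg_cst].
have c2 : (fun y : R * R => y.2 / s.2) y @[y --> x] --> x.2 / s.2.
  by apply: cvgM; [exact: f2|exact: cvg_cst].
apply: cvgM; last exact: cvg_cst.
apply: cvgD; last exact: (cvgM c2 c2).
apply: cvgB; first exact: (cvgM c1 c1).
apply: cvgM; last exact: c2.
by apply: cvgM; [exact: cvg_cst|exact: c1].
Qed.

Lemma measurable_gform : measurable_fun setT gform.
Proof.
rewrite /gform /mahal/=.
apply: measurable_funM => //; apply: measurable_funD.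
  apply: measurable_funB.
    by apply/measurable_funX; apply: measurable_funM.
  apply: measurable_funM; last exact: measurable_funM.
  by apply: measurable_funM => //; exact: measurable_funM.
by apply/measurable_funX; apply: measurable_funM.
Qed.

Lemma measurable_expR_gform A : measurable A ->
  measurable_fun A (fun x => (expR (- (gform x / 2)))%:E).
Proof.
move=> mA; apply/measurable_EFinP; apply: measurableT_comp => //.
apply: measurable_funN; apply: measurable_funM => //.
exact: measurable_funS measurable_gform.
Qed.

(** Continuity at [y], kept only on a square beyond [y]: such a square lies in the orthant and has
    positive area. *)
Lemma gform_near_corner y (e : R) : 0 < e -> exists2 r : R, 0 < r &
  forall x, y.1 < x.1 < y.1 + r -> y.2 < x.2 < y.2 + r ->
    gform x < gform y + e.
Proof.
move=> e0; have /cvgr_lt/(_ (gform y + e)) := @continuous_gform y.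
rewrite ltrDl => /(_ e0) /nbhs_ballP[r /= r0 H]; exists r => // x x1 x2.
apply: H; split => /=; rewrite /ball/= ltr_norml; lra.
Qed.

(** The exponent is split: the fraction [1 - e] of the form is bounded below by [q] on [A], and the
    remaining fraction [e] gives an integral over the whole plane, so [K] depends on neither [A] nor
    [q]. *)
Lemma integral_gform_ub (e : R) : 0 < e < 1 -> exists2 K : R, 0 < K &
  forall A (q : R), measurable A -> (forall x, A x -> q <= gform x) ->
  (\int[lebesgue2]_(x in A) (expR (- (gform x / 2)))%:E <=
     (K * expR (- ((1 - e) * q / 2)))%:E)%E.
Proof.
move=> /andP[e0 e1].
(* One factor 1/2 comes from the Gaussian exponent, the other from [gform_ge_sqr]. *)
pose c1 := e / 4 * s.1 ^- 2; pose c2 := e / 4 * s.2 ^- 2.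
have c10 : 0 < c1 by rewrite mulr_gt0 ?divr_gt0// invr_gt0 exprn_gt0.
have c20 : 0 < c2 by rewrite mulr_gt0 ?divr_gt0// invr_gt0 exprn_gt0.
have [K K0 KE] := integral_expRN_sqnorm_fin c10 c20.
exists K => // A q mA Aq.
rewrite mulrC EFinM -KE.
have mf (B : set (R * R)) : measurable B -> measurable_fun B
    (fun x => (expR (- (c1 * x.1 ^+ 2 + c2 * x.2 ^+ 2)))%:E).
  move=> mB; apply: (@measurable_funS _ _ _ _ setT) => //.
  apply/measurable_EFinP; apply: measurableT_comp => //.
  apply: measurable_funN; apply: measurable_funD; apply: measurable_funM => //;
    exact/measurable_funX.
rewrite -ge0_integralZl//=; last exact: mf.
apply: (@le_trans _ _ (\int[lebesgue2]_(x in A) ((expR (- ((1 - e) * q / 2)))%:E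
   * (expR (- (c1 * x.1 ^+ 2 + c2 * x.2 ^+ 2)))%:E)))%E.
  apply: ge0_le_integral => //.
  - exact: measurable_expR_gform.
  - by apply: measurable_funeM; exact: mf.
  - move=> x Ax; rewrite -EFinM -expRD lee_fin ler_expR.
    have h1 := gform_ge_sqr x; have h2 := Aq _ Ax.
    have h3 : e * ((s.1 ^- 2 * x.1 ^+ 2 + s.2 ^- 2 * x.2 ^+ 2) / 2) <=
        e * gform x by rewrite ler_pM2l.
    have h4 : (1 - e) * q <= (1 - e) * gform x by rewrite ler_pM2l// subr_gt0.
    rewrite /c1 /c2; lra.
apply: ge0_subset_integral => //.
by apply: measurable_funeM; exact: mf.
Qed.

(** Only a small square at the corner [y], dilated by [a], is integrated over. Its area is
    [a ^+ 2 * r ^+ 2], which is at least [r ^+ 2] as [1 <= a]. *)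
Lemma integral_gform_lb y (e : R) : 0 < e -> exists2 k : R, 0 < k &
  forall A (a : R), 1 <= a -> measurable A ->
  (forall x, vgt x (a * y.1, a * y.2) -> A x) ->
  ((k * expR (- (a ^+ 2 * (gform y + e) / 2)))%:E <=
     \int[lebesgue2]_(x in A) (expR (- (gform x / 2)))%:E)%E.
Proof.
move=> e0; have [r r0 rH] := gform_near_corner y e0.
exists (r ^+ 2); first exact: exprn_gt0.
move=> A a a1 mA AH.
have a0 : 0 < a := lt_le_trans ltr01 a1.
pose B := `]a * y.1, a * (y.1 + r)[%classic `*` `]a * y.2, a * (y.2 + r)[%classic.
have mB : measurable B by exact: measurableX.
have BA : B `<=` A.
  move=> x [] /=; rewrite !in_itv/= => /andP[x1 _] /andP[x2 _].
  by apply: AH; rewrite /vgt/= x1.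
apply: (@le_trans _ _
  (\int[lebesgue2]_(x in B) (expR (- (gform x / 2)))%:E))%E; last first.
  apply: ge0_subset_integral => //.
  exact: measurable_expR_gform.
apply: (@le_trans _ _ (\int[lebesgue2]_(x in B)
  (expR (- (a ^+ 2 * (gform y + e) / 2)))%:E))%E; last first.
  apply: ge0_le_integral => //.
  - exact: measurable_expR_gform.
  move=> x [] /=; rewrite !in_itv/= => x1 x2.
  rewrite lee_fin ler_expR lerN2 ler_pM2r ?invr_gt0//.
  have -> : x = (a * (x.1 / a, x.2 / a).1, a * (x.1 / a, x.2 / a).2).
    by rewrite /= !(mulrC a) !divfK ?gt_eqF// -surjective_pairing.
  rewrite gform_scale ler_pM2l ?exprn_gt0// ltW// rH//=.
    by rewrite ltr_pdivlMr// ltr_pdivrMr// !(mulrC _ a).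
  by rewrite ltr_pdivlMr// ltr_pdivrMr// !(mulrC _ a).
have BE : lebesgue2 B =
    ((a * (y.1 + r) - a * y.1) * (a * (y.2 + r) - a * y.2))%:E.
  by rewrite /B lebesgue2_rect// ler_pM2l// lerDl ltW.
rewrite integral_cst// muleC [X in (_ <= X * _)%E]BE.
rewrite -EFinM lee_fin ler_pM2r ?expR_gt0//.
have -> : (a * (y.1 + r) - a * y.1) * (a * (y.2 + r) - a * y.2) =
  a ^+ 2 * r ^+ 2 by ring.
by rewrite ler_peMl ?sqr_ge0// exprn_ege1.
Qed.

End gaussian_form.

Section gaussian_form_inf.
Context {R : realType}.
Variables (rho : R) (s : R * R).
Hypotheses (rho1 : rho ^+ 2 < 1) (s1_gt0 : 0 < s.1) (s2_gt0 : 0 < s.2).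
Local Notation gform := (gform rho s).

(* [A n] stands for [a_ n] times a set on which [gform] is minimal at its corner
   [y]. *)
Lemma log_rate_gform (c : R) (A : nat -> set (R * R)) (p : nat -> R) (y : R * R) :
  0 < c -> 0 < gform y -> (forall n, measurable (A n)) ->
  (forall n x, A n x -> (@a_ R n) ^+ 2 * gform y <= gform x) ->
  (forall n x, vgt x (a_ n * y.1, a_ n * y.2) -> A n x) ->
  (forall n, (p n)%:E =
    (c%:E * \int[lebesgue2]_(x in A n) (expR (- (gform x / 2)))%:E)%E) ->
  log_rate p (- (gform y / 2)).
Proof.
move=> c0 q0 mA Age Asub pE; apply: log_rate_sandwich => e e0.
(* The Gaussian exponent is halved, so a slack of [2 * e] in the form costs [e] in the rate. *)
have e20 : 0 < 2 * e by rewrite mulr_gt0.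
have qe0 : 0 < gform y + e by exact: addr_gt0.
have [k k0 lb] := integral_gform_lb rho s y e20.
(* This fraction is below 1, and its product with [gform y] is at most [e]. *)
have [|K K0 ub] := integral_gform_ub rho1 s1_gt0 s2_gt0 (e := e / (gform y + e)).
  by rewrite divr_gt0//= ltr_pdivrMr// mul1r ltrDr.
exists (c * k), (c * K); split; [exact: mulr_gt0..|].
near=> n.
have a1 : 1 <= (@a_ R n).
  near: n; have /cvgryPge/(_ 1) := @cvg_sqr_a_ R; apply: filterS => n.
  by rewrite -{1}(expr1n R 2) ler_sqr ?nnegrE ?sqrtr_ge0.
rewrite -(mulrA c k) -(mulrA c K) -!lee_fin pE !(EFinM c) !lee_pmul2l//.
apply/andP; split.
  apply: le_trans (lb _ _ a1 (mA n) (Asub n)).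
  by rewrite lee_fin ler_pM2l// ler_expR; lra.
apply: le_trans (ub _ _ (mA n) (Age n)) _.
rewrite lee_fin ler_pM2l// ler_expR.
have : e / (gform y + e) * gform y <= e.
  by rewrite mulrAC ler_pdivrMr// ler_pM2l// lerDl ltW.
rewrite -subr_ge0 => h.
have : 0 <= (@a_ R n) ^+ 2 * (e - e / (gform y + e) * gform y).
  by rewrite mulr_ge0// sqr_ge0.
have : 0 <= (@a_ R n) ^+ 2 * e by rewrite mulr_ge0 ?sqr_ge0// ltW.
set t := e / _; lra.
Unshelve. all: by end_near. Qed.

(** The corner [y] need not belong to [D], but a bound larger than [gform y] would fail on a whole
    square next to [y], which is not a null set. *)
Lemma ess_inf_on_gform (D : set (R * R)) y :
  (forall x, vgt x y -> D x) -> (forall x, D x -> gform y <= gform x) ->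
  ess_inf_on D gform = (gform y)%:E.
Proof.
move=> Dy Dge; apply/eqP; rewrite eq_le; apply/andP; split; last first.
  apply/ess_infP; apply: nearW => x; rewrite /patch.
  by case: ifPn => [/set_mem/Dge|_]; rewrite ?lee_fin ?leey.
rewrite leNgt; apply/negP => lt.
(* [e] is the gap assumed for contradiction, or 1 when the essential infimum is [+oo]. *)
have [e e0 ele] : exists2 e : R, 0 < e &
    ((gform y + e)%:E <= ess_inf_on D gform)%E.
  case E: (ess_inf_on D gform) lt => [r| |] //=.
    rewrite lte_fin => lt; exists (r - gform y); first by rewrite subr_gt0.
    by rewrite subrKC.
  by exists 1; rewrite ?leey.
have [r r0 rH] := gform_near_corner rho s y e0.
move/ess_infP: ele.
move=> [N [mN N0 sub]].
pose B := `]y.1, y.1 + r[%classic `*` `]y.2, y.2 + r[%classic.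
have BN : B `<=` N.
  move=> x [] /=; rewrite !in_itv/= => x1 x2; apply: sub => /=.
  rewrite /patch mem_set; last first.
    by apply: Dy; rewrite /vgt; move: x1 x2 => /andP[-> _] /andP[-> _].
  by rewrite /= lee_fin; apply/negP; rewrite -ltNge rH.
have : (lebesgue2 B <= lebesgue2 N)%E.
  by apply: le_measure => //; rewrite inE; first exact: measurableX.
have BE : lebesgue2 B = ((y.1 + r - y.1) * (y.2 + r - y.2))%:E.
  by rewrite /B lebesgue2_rect// lerDl ltW.
rewrite [X in (_ <= X)%E]N0 [X in (X <= _)%E]BE lee_fin leNgt.
by rewrite !(addrC _ r) !addrK mulr_gt0.
Qed.

End gaussian_form_inf.

(** * Exceedances in an i.i.d. sequence *)

Section exceedance_rate.
Context {R : realType}.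

(** A division-free form of [(1 - p) ^+ n <= 1 / (1 + n p)]; the inductive step is
    [(1 - p) * (1 + (n + 1) p) <= 1 + n p]. *)
Lemma compl_exp_ge (p : R) (n : nat) : 0 <= p <= 1 ->
  (1 - p) ^+ n * (1 + n%:R * p) <= 1.
Proof.
move=> /andP[p0 p1]; elim: n => [|n IH]; first by rewrite expr0 mul0r addr0 mulr1.
apply: le_trans IH; rewrite exprSr -mulrA ler_wpM2l ?exprn_ge0 ?subr_ge0//.
rewrite -natr1; have := mulr_ge0 (ler0n R n) (sqr_ge0 p).
by have := sqr_ge0 p; nra.
Qed.

(** With [t = m p <= 1] the left-out mass is at least [t / (1 + t) >= t / 2], and [n p <= 3 t] gives
    the factor 1/6. It serves for [m = n] and for [m = n./2]. *)
Lemma one_sub_compl_exp_lb (p : R) (m n : nat) : 0 <= p <= 1 ->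
  n%:R * p <= 1 -> (m <= n)%N -> (n <= 3 * m)%N ->
  6^-1 * (n%:R * p) <= 1 - (1 - p) ^+ m.
Proof.
move=> p01 np mn n3m; have := compl_exp_ge m p01.
have /andP[p0 p1] := p01.
have h1 : m%:R * p <= n%:R * p by rewrite ler_wpM2r// ler_nat.
have h2 : n%:R * p <= 3 * (m%:R * p) by rewrite mulrA ler_wpM2r// -natrM ler_nat.
have h3 : 0 <= m%:R * p by rewrite mulr_ge0.
have h4 : 0 <= (1 - p) ^+ m by rewrite exprn_ge0 ?subr_ge0.
by move: h1 h2 h3 h4; set q := _ ^+ m; set t := m%:R * p; nra.
Qed.

(** Rates below -1 make [n p] tend to 0, so each hitting probability is comparable to [n p]. The
    lower and upper bounds for [pE] then have the same rate, the larger of the two exponents. *)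
Lemma log_rate_exceedance (p1 p2 p12 pE : nat -> R) (r1 r2 r12 : R) :
  log_rate p1 r1 -> log_rate p2 r2 -> log_rate p12 r12 ->
  r1 < -1 -> r2 < -1 -> r12 < -1 ->
  (forall n, 0 <= p1 n <= 1) -> (forall n, 0 <= p2 n <= 1) ->
  (forall n, 0 <= p12 n <= 1) ->
  (\forall n \near \oo, 1 - (1 - p12 n) ^+ n <= pE n) ->
  (\forall n \near \oo,
     (1 - (1 - p1 n) ^+ n./2) * (1 - (1 - p2 n) ^+ n./2) <= pE n) ->
  (\forall n \near \oo,
     pE n <= n%:R * p12 n + n%:R * p1 n * (n%:R * p2 n)) ->
  log_rate pE (Num.max (2 + r1 + r2) (1 + r12)).
Proof.
move=> R1 R2 R12 l1 l2 l12 p1b p2b p12b lb1 lb2 ub.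
have N1 := log_rateM (@log_rate_nat R) R1.
have N2 := log_rateM (@log_rate_nat R) R2.
have N12 := log_rateM (@log_rate_nat R) R12.
have NN := log_rateM N1 N2.
have sixth : 0 < 6^-1 :> R by rewrite invr_gt0.
have c6 := log_rate_cst sixth.
have L1 := log_rateM c6 N1; have L2 := log_rateM c6 N2.
have L12 := log_rateM c6 N12.
have LL := log_rateM L1 L2.
have ltN (r : R) : r < -1 -> 1 + r < 0 by move=> ?; lra.
have le1 (p : nat -> R) r : log_rate p r -> r < 0 -> \forall n \near \oo, p n <= 1.
  move=> pr r0; have /cvgr_lt/(_ 1 ltr01) := log_rate_lt0_cvg0 pr r0.
  by apply: filterS => n /ltW.
have e1 := le1 _ _ N1 (ltN _ l1); have e2 := le1 _ _ N2 (ltN _ l2).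
have e12 := le1 _ _ N12 (ltN _ l12).
have -> : 2 + r1 + r2 = 1 + r1 + (1 + r2) by ring.
rewrite maxC; apply: (log_rate_squeeze _ (log_rateD N12 NN)).
  have := log_rate_max L12 LL; rewrite !add0r; exact.
(* The inequality [n <= 3 * n./2] is tight at [n = 3] and fails at [n = 1]. *)
have half n : (1 < n)%N -> (n./2 <= n)%N && (n <= 3 * n./2)%N.
  by move=> n1; have := odd_double_half n; case: odd; lia.
near=> n.
have n1 : (1 < n)%N by near: n; exact: nbhs_infty_gt.
have /andP[hn nh] := half _ n1.
apply/andP; split; last by near: n.
rewrite ge_max; apply/andP; split.
  apply: (@le_trans _ _ (1 - (1 - p12 n) ^+ n)); last by near: n.
  apply: one_sub_compl_exp_lb => //; last by lia.
  by near: n.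
apply: (@le_trans _ _ ((1 - (1 - p1 n) ^+ n./2) *
  (1 - (1 - p2 n) ^+ n./2))); last by near: n.
have p1n : n%:R * p1 n <= 1 by near: n.
have p2n : n%:R * p2 n <= 1 by near: n.
have /andP[p10 _] := p1b n; have /andP[p20 _] := p2b n.
apply: ler_pM.
- by rewrite !mulr_ge0// ltW.
- by rewrite !mulr_ge0// ltW.
- exact: one_sub_compl_exp_lb.
- exact: one_sub_compl_exp_lb.
Unshelve. all: by end_near. Qed.

Lemma log_rate_ratio_cvg0 (b f g : nat -> R) (r s : R) :
  log_rate f r -> log_rate g s -> r < s ->
  (\forall n \near \oo, 0 <= b n <= f n) -> b n / g n @[n --> \oo] --> 0.
Proof.
move=> fr gs rs bf; have := log_rateM fr (log_rateV gs).
move=> /log_rate_lt0_cvg0; rewrite subr_lt0 => /(_ rs) H.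
apply: (squeeze_cvgr _ (cvg_cst 0) H); case: gs => g0 _.
apply: filterS2 bf g0 => n /andP[b0 bf] g0.
by rewrite divr_ge0 ?(ltW g0)//= ler_wpM2r// invr_ge0 ltW.
Qed.

End exceedance_rate.

Lemma prodr_seq_const (R : comNzRingType) (T : eqType) (I : seq T) (f : T -> R)
    (c : R) :
  {in I, forall i, f i = c} -> \prod_(i <- I) f i = c ^+ size I.
Proof.
move=> fc; rewrite big_seq (eq_bigr (fun=> c))// -big_seq.
by rewrite big_const_seq count_predT iter_mulr_1.
Qed.

Section iid_hits.
Context {d : measure_display} {T : measurableType d} {R : realType}.
Variables (P : probability T R) (X : nat -> {RV P >-> (R * R)%type}).
Hypotheses (Xindep : mutually_independent X) (Xident : identically_distributed X).
Implicit Types (A B : set T) (U V : set (R * R)) (F : nat -> set T).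
Local Notation Pr A := (fine (P A)).

Lemma fine_probK A : measurable A -> (Pr A)%:E = P A.
Proof. by move=> mA; rewrite fineK// fin_num_measure. Qed.

Lemma fine_prob_le A B : measurable A -> measurable B -> A `<=` B -> Pr A <= Pr B.
Proof. by move=> mA mB AB; rewrite -lee_fin !fine_probK// le_measure// inE. Qed.

Lemma fine_prob_ge0 A : 0 <= Pr A.
Proof. exact: fine_ge0. Qed.

Lemma fine_prob_bound A : measurable A -> 0 <= Pr A <= 1.
Proof. by move=> mA; rewrite fine_prob_ge0 -lee_fin fine_probK// probability_le1. Qed.

Lemma fine_prob_setC A : measurable A -> Pr (~` A) = 1 - Pr A.
Proof.
move=> mA; apply: EFin_inj; rewrite fine_probK; last exact: measurableC.
by rewrite probability_setC// EFinB fine_probK.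
Qed.

Lemma fine_prob_setU_le A B : measurable A -> measurable B ->
  Pr (A `|` B) <= Pr A + Pr B.
Proof.
move=> mA mB; rewrite -lee_fin EFinD !fine_probK//; last exact: measurableU.
exact: measureU2.
Qed.

Lemma fine_prob_setDI A B : measurable A -> measurable B ->
  Pr A = Pr (A `\` B) + Pr (A `&` B).
Proof.
move=> mA mB; apply: EFin_inj; rewrite EFinD !fine_probK//.
- exact: measureDI.
- exact: measurableI.
- exact: measurableD.
Qed.

Lemma fine_prob_bigcup_le F (n : nat) (c : R) : (forall i, measurable (F i)) ->
  (forall i, Pr (F i) <= c) -> Pr (\bigcup_(i in `I_n) F i) <= n%:R * c.
Proof.
move=> mF Fc; rewrite -lee_fin fine_probK; last exact: fin_bigcup_measurable.
rewrite bigcup_mkord; apply: (le_trans (Boole_inequality P _)) => [i _|]; first exact: mF.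
apply: (@le_trans _ _ (\sum_(i < n) c%:E)%E).
  by apply: lee_sum => i _; have := Fc i; rewrite -lee_fin fine_probK.
by rewrite sumEFin sumr_const card_ord mulr_natl.
Qed.

Lemma fine_prob_preimage (i : nat) U : measurable U ->
  Pr (X i @^-1` U) = Pr (X 0%N @^-1` U).
Proof. by move=> mU; have := Xident i mU; rewrite /distribution/= /pushforward => ->. Qed.

Lemma measurable_preimage_RV (i : nat) U : measurable U -> measurable (X i @^-1` U).
Proof. by move=> mU; rewrite -[X in measurable X]setTI; exact: measurable_funP. Qed.

Lemma fine_prob_indep (s : seq nat) (B : nat -> set (R * R)) :
  uniq s -> (forall i, measurable (B i)) ->
  Pr (\bigcap_(i in [set` s]) (X i @^-1` B i)) =
  \prod_(i <- s) Pr (X 0%N @^-1` B i).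
Proof.
move=> us mB; apply: EFin_inj; rewrite -prodEFin fine_probK; last first.
  by apply: bigcap_measurableType => // i _; exact: measurable_preimage_RV.
rewrite (Xindep us mB); apply: eq_bigr => i _.
by rewrite -(fine_prob_preimage i)// fine_probK//; exact: measurable_preimage_RV.
Qed.

(** Indices form a sequence to match [mutually_independent]; disjoint index blocks are then
    expressed by [uniq (I ++ J)]. *)
Definition hits (I : seq nat) U : set T := \bigcup_(i in [set` I]) (X i @^-1` U).

Lemma measurable_hits I U : measurable U -> measurable (hits I U).
Proof. by move=> mU; apply: bigcup_measurable => i _; exact: measurable_preimage_RV. Qed.

Lemma hits1 (i : nat) U : hits [:: i] U = X i @^-1` U.
Proof.
apply/seteqP; split=> w; first by move=> [j /=]; rewrite inE => /eqP ->.
by exists i; rewrite //= mem_head.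
Qed.

Lemma hitsC I U : ~` hits I U = \bigcap_(i in [set` I]) (X i @^-1` ~` U).
Proof. by rewrite /hits setC_bigcup. Qed.

Lemma fine_prob_hitsC I U : uniq I -> measurable U ->
  Pr (~` hits I U) = (1 - Pr (X 0%N @^-1` U)) ^+ size I.
Proof.
move=> uI mU; rewrite hitsC (fine_prob_indep (B := fun=> ~` U))//; last first.
  by move=> _; exact: measurableC.
apply: prodr_seq_const => i _; rewrite -preimage_setC fine_prob_setC//.
exact: measurable_preimage_RV.
Qed.

(** Complements of hits are finite intersections, which factor by independence; the product rule
    then passes from the complements to the events. *)
Lemma fine_prob_hitsI I J U V : uniq (I ++ J) -> measurable U -> measurable V ->
  Pr (hits I U `&` hits J V) = Pr (hits I U) * Pr (hits J V).
Proof.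
move=> uIJ mU mV.
have /and3P[uI IJ uJ] : [&& uniq I, ~~ has (mem I) J & uniq J] by rewrite -cat_uniq.
have mI := measurable_hits I mU; have mJ := measurable_hits J mV.
have E : Pr (~` hits I U `&` ~` hits J V) = Pr (~` hits I U) * Pr (~` hits J V).
  (* A single family of target sets covers both blocks, so independence is applied once to
     [I ++ J]. *)
  pose B i := if i \in I then ~` U else ~` V.
  have mB i : measurable (B i) by rewrite /B; case: ifP => _; exact: measurableC.
  have -> : ~` hits I U `&` ~` hits J V = \bigcap_(i in [set` I ++ J]) (X i @^-1` B i).
    rewrite !hitsC; apply/seteqP; split => w.
      move=> [wI wJ] i /=; rewrite mem_cat /B; case: ifPn => [iI _|_ /= iJ].
        exact: wI.
      exact: wJ.
    move=> H; split => i /= iI.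
      by have := H i; rewrite /= mem_cat /B iI; exact.
    have := H i; rewrite /= mem_cat /B iI orbT ifN; first exact.
    by apply: contra IJ => iI'; apply/hasP; exists i.
  rewrite fine_prob_indep// big_cat/= !fine_prob_hitsC//.
  have cst (s : seq nat) (W : set (R * R)) : measurable W ->
      {in s, forall i, B i = ~` W} ->
      \prod_(i <- s) Pr (X 0%N @^-1` B i) = (1 - Pr (X 0%N @^-1` W)) ^+ size s.
    move=> mW sB; rewrite -fine_prob_setC//; last exact: measurable_preimage_RV.
    by apply: prodr_seq_const => i /sB ->; rewrite -preimage_setC.
  rewrite (cst _ U)//; last by move=> i iI; rewrite /B iI.
  rewrite (cst _ V)// => i iJ; rewrite /B ifN//.
  by apply: contra IJ => iI; apply/hasP; exists i.
have mCI := measurableC mI; have mCJ := measurableC mJ.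
have h1 := fine_prob_setDI mI mJ.
have h2 := fine_prob_setDI mCJ mI.
have h3 : Pr (~` hits J V `\` hits I U) = Pr (~` hits I U `&` ~` hits J V).
  by rewrite setDE setIC.
have h4 : Pr (hits I U `\` hits J V) = Pr (~` hits J V `&` hits I U).
  by rewrite setDE setIC.
move: E h1 h2 h3 h4; rewrite !fine_prob_setC// => E h1 h2 h3 h4; lra.
Qed.

(** The empty set on the diagonal keeps this a full double union, to which the union bound applies
    twice. *)
Definition distinct_hits (n : nat) U V : set T :=
  \bigcup_(i in `I_n) \bigcup_(j in `I_n)
    (if i == j then set0 else X i @^-1` U `&` X j @^-1` V).

Lemma measurable_distinct_hits n U V : measurable U -> measurable V ->
  measurable (distinct_hits n U V).
Proof.
move=> mU mV; apply: bigcup_measurable => i _; apply: bigcup_measurable => j _.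
by case: ifP => // _; apply: measurableI; exact: measurable_preimage_RV.
Qed.

Lemma fine_prob_distinct_hits n U V : measurable U -> measurable V ->
  Pr (distinct_hits n U V) <=
  n%:R * Pr (X 0%N @^-1` U) * (n%:R * Pr (X 0%N @^-1` V)).
Proof.
move=> mU mV; rewrite mulrACA -mulrA.
have mij i j : measurable (if i == j then set0 else X i @^-1` U `&` X j @^-1` V).
  by case: ifP => // _; apply: measurableI; exact: measurable_preimage_RV.
apply: fine_prob_bigcup_le => i; first by apply: bigcup_measurable => j _.
apply: fine_prob_bigcup_le => // j; case: ifPn => [_|ij].
  by rewrite measure0 mulr_ge0// fine_prob_ge0.
have -> : X i @^-1` U `&` X j @^-1` V = hits [:: i] U `&` hits [:: j] V.
  by rewrite !hits1.
rewrite fine_prob_hitsI//=; last by rewrite inE ij.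
rewrite !hits1 !(fine_prob_preimage i)//.
by rewrite (fine_prob_preimage j).
Qed.

Lemma fine_prob_hits_le n U : measurable U ->
  Pr (hits (iota 0 n) U) <= n%:R * Pr (X 0%N @^-1` U).
Proof.
move=> mU.
have -> : hits (iota 0 n) U = \bigcup_(i in `I_n) (X i @^-1` U).
  by apply: eq_bigcupl; split => i /=; rewrite mem_iota.
apply: fine_prob_bigcup_le => i; first exact: measurable_preimage_RV.
by rewrite fine_prob_preimage.
Qed.

Lemma hitsI_sub n U V : hits (iota 0 n) U `&` hits (iota 0 n) V `<=`
  hits (iota 0 n) (U `&` V) `|` distinct_hits n U V.
Proof.
move=> w [[i /= iN Ui] [j /= jN Vj]].
have [ij|ij] := eqVneq i j; first by left; exists i => //; split => //=; rewrite ij.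
right; move: iN jN; rewrite !mem_iota/= => iN jN.
by exists i => //; exists j => //; rewrite (negbTE ij).
Qed.

(** The lower bounds come from a common index and from hits in two disjoint halves; the upper bound
    separates common from distinct indices. *)
Lemma fine_prob_hitsI_bounds n U V : measurable U -> measurable V ->
  [/\ 1 - (1 - Pr (X 0%N @^-1` (U `&` V))) ^+ n
        <= Pr (hits (iota 0 n) U `&` hits (iota 0 n) V),
      (1 - (1 - Pr (X 0%N @^-1` U)) ^+ n./2) *
        (1 - (1 - Pr (X 0%N @^-1` V)) ^+ n./2)
        <= Pr (hits (iota 0 n) U `&` hits (iota 0 n) V) &
      Pr (hits (iota 0 n) U `&` hits (iota 0 n) V) <=
        n%:R * Pr (X 0%N @^-1` (U `&` V)) +
        n%:R * Pr (X 0%N @^-1` U) * (n%:R * Pr (X 0%N @^-1` V))].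
Proof.
move=> mU mV; have mUV := measurableI _ _ mU mV.
have mE : measurable (hits (iota 0 n) U `&` hits (iota 0 n) V).
  by apply: measurableI; exact: measurable_hits.
have hitsE I W : uniq I -> measurable W ->
    1 - (1 - Pr (X 0%N @^-1` W)) ^+ size I = Pr (hits I W).
  move=> uI mW; rewrite -fine_prob_hitsC// fine_prob_setC ?subKr//.
  exact: measurable_hits.
split.
- rewrite -{1}(size_iota 0 n) hitsE ?iota_uniq//.
  apply: fine_prob_le => //; first exact: measurable_hits.
  by move=> w [i iN [Ui Vi]]; split; exists i.
(* [U] is sought in the first block of length [n./2] and [V] in the next one; for odd [n] the last
   index is left out. *)
- rewrite -{1}(size_iota 0 n./2) -{2}(size_iota n./2 n./2).
  rewrite !hitsE ?iota_uniq// -fine_prob_hitsI//; last first.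
    by have := iota_uniq 0 (n./2 + n./2); rewrite iotaD add0n.
  apply: fine_prob_le => //; first by apply: measurableI; exact: measurable_hits.
  have := odd_double_half n; rewrite -addnn => n2.
  move=> w [[i /= iN Ui] [j /= jN Vj]]; move: iN jN; rewrite !mem_iota => iN jN.
  by split; [exists i|exists j] => //=; rewrite mem_iota; lia.
- apply: le_trans (lerD (fine_prob_hits_le n mUV) (fine_prob_distinct_hits n mU mV)).
  apply: le_trans (fine_prob_setU_le (measurable_hits _ mUV)
    (measurable_distinct_hits n mU mV)).
  apply: fine_prob_le => //; last exact: hitsI_sub.
  by apply: measurableU; [exact: measurable_hits|exact: measurable_distinct_hits].
Qed.

End iid_hits.

(** * The law of a nondegenerate Gaussian vector *)

Section covariance_form.
Context {R : realType}.
Implicit Types (S : 'M[R]_2) (x s : R * R).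

Lemma det_mx2 S : \det S = S 0 0 * S 1 1 - S 0 1 * S 1 0.
Proof.
rewrite (expand_det_row _ ord0) !big_ord_recl big_ord0 /cofactor !det_mx11 !mxE/=.
rewrite addr0 expr0 expr1 mul1r mulN1r mulrN.
by congr (_ * S _ _ - S _ _ * S _ _); apply/val_inj.
Qed.

Definition mx2 (a b c e : R) : 'M[R]_2 :=
  \matrix_(i, j) if i == 0 then (if j == 0 then a else b)
                 else (if j == 0 then c else e).

Lemma mx2_eta S : S = mx2 (S 0 0) (S 0 1) (S 1 0) (S 1 1).
Proof.
apply/matrixP => i j; rewrite !mxE.
by case: i => -[|[|//]] hi; case: j => -[|[|//]] hj /=; congr (S _ _); apply/val_inj.
Qed.

Lemma inv_quad_form_gform S (rho : R) s x : rho ^+ 2 < 1 -> 0 < s.1 -> 0 < s.2 ->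
  S = mx2 (s.1 ^+ 2) (rho * (s.1 * s.2)) (rho * (s.1 * s.2)) (s.2 ^+ 2) ->
  inv_quad_form S (colvec x) = gform rho s x.
Proof.
move=> rho1 s1 s2 SE.
have n1 : s.1 != 0 by rewrite gt_eqF.
have n2 : s.2 != 0 by rewrite gt_eqF.
have nr : 1 - rho ^+ 2 != 0 by rewrite gt_eqF// subr_gt0.
(* The explicit inverse; checking [N *m S = 1%:M] identifies it with [invmx S]. *)
pose N := mx2 ((s.1 ^+ 2 * (1 - rho ^+ 2))^-1)
  (- rho / (s.1 * s.2 * (1 - rho ^+ 2)))
  (- rho / (s.1 * s.2 * (1 - rho ^+ 2))) ((s.2 ^+ 2 * (1 - rho ^+ 2))^-1).
have NS : N *m S = 1%:M.
  apply/matrixP => i j; rewrite SE !mxE !big_ord_recl big_ord0 !mxE/=.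
  case: i => -[|[|//]] hi; case: j => -[|[|//]] hj /=; rewrite ?mulr1n ?mulr0n; field;
    by rewrite ?n1 ?n2 ?nr.
have [_ uS] := mulmx1_unit NS.
have -> : inv_quad_form S (colvec x) = ((colvec x)^T *m N *m colvec x) ord0 ord0.
  by rewrite /inv_quad_form -[in RHS](mulmxK uS N) NS mul1mx.
rewrite !mxE !big_ord_recl !big_ord0 !mxE !big_ord_recl !big_ord0 !mxE/=.
rewrite /gform /mahal/=.
by field; rewrite n1 n2 nr.
Qed.

End covariance_form.

Section gaussian_law.
Context {d : measure_display} {T : measurableType d} {R : realType}.
Variables (P : probability T R) (Y : {RV P >-> (R * R)%type}).

Lemma colvec_fst : (fun w => colvec (Y w) ord0 ord0) = fst \o Y.
Proof. by apply/funext => w; rewrite mxE. Qed.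

Lemma colvec_snd : (fun w => colvec (Y w) 1 ord0) = snd \o Y.
Proof. by apply/funext => w; rewrite mxE. Qed.

Lemma covmxE : covmx P Y =
  mx2 (fine 'V_P[fst \o Y]) (fine (covariance P (fst \o Y) (snd \o Y)))
      (fine (covariance P (fst \o Y) (snd \o Y))) (fine 'V_P[snd \o Y]).
Proof.
rewrite [LHS]mx2_eta !mxE colvec_fst colvec_snd.
by rewrite (covarianceC P (snd \o Y) (fst \o Y)).
Qed.

(* Otherwise [Num.sqrt (\det S)] is 0, and so is the density, as 1 / 0 = 0. *)
Lemma gaussian2_det_gt0 : nondegenerate_gaussian2 Y -> 0 < \det (covmx P Y).
Proof.
move=> [_ law]; rewrite ltNge; apply/negP => det0.
have := law setT measurableT.
rewrite (eq_integral (cst 0%E)) => [|x _]; last first.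
  by rewrite /gaussian2_pdf (ler0_sqrtr det0) mulr0 invr0 mulr0.
rewrite integral0 /distribution/= /pushforward preimage_setT probability_setT.
by move/eqP; rewrite onee_eq0.
Qed.

Let s := (stdev P (fst \o Y), stdev P (snd \o Y)).
Let rho := correlation P (fst \o Y) (snd \o Y).

(** All four claims follow from the determinant: [c ^+ 2 < a * b] forces both variances to be
    positive and the squared correlation to be below 1. *)
Lemma gaussian2_parameters : nondegenerate_gaussian2 Y ->
  [/\ 0 < s.1, 0 < s.2, rho ^+ 2 < 1 &
  covmx P Y = mx2 (s.1 ^+ 2) (rho * (s.1 * s.2)) (rho * (s.1 * s.2)) (s.2 ^+ 2)].
Proof.
move=> /gaussian2_det_gt0; rewrite det_mx2 covmxE !mxE/=.
rewrite /s /rho /correlation /stdev/=.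
set a := fine 'V_P[fst \o Y]; set b := fine 'V_P[snd \o Y].
set c := fine (covariance _ _ _) => det0.
have a0 : 0 <= a by apply: fine_ge0; exact: variance_ge0.
have b0 : 0 <= b by apply: fine_ge0; exact: variance_ge0.
have ab : c ^+ 2 < a * b by rewrite -subr_gt0 expr2.
have ab0 : 0 < a * b := le_lt_trans (sqr_ge0 c) ab.
have a_gt0 : 0 < a.
  rewrite lt_neqAle a0 andbT eq_sym.
  by apply: contraTneq ab0 => ->; rewrite mul0r ltxx.
have b_gt0 : 0 < b by rewrite -(pmulr_rgt0 _ a_gt0).
have sa0 : 0 < Num.sqrt a by rewrite sqrtr_gt0.
have sb0 : 0 < Num.sqrt b by rewrite sqrtr_gt0.
split => //.
  by rewrite expr_div_n exprMn !sqr_sqrtr// ltr_pdivrMr// mul1r.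
by rewrite !sqr_sqrtr// divfK// mulf_neq0// gt_eqF.
Qed.

Lemma gaussian2_law (A : set (R * R)) : nondegenerate_gaussian2 Y ->
  ('E_P[fst \o Y] = 0)%E -> ('E_P[snd \o Y] = 0)%E -> measurable A ->
  P (Y @^-1` A) = (((2 * pi * Num.sqrt (\det (covmx P Y)))^-1)%:E *
    \int[lebesgue2]_(x in A) (expR (- (gform rho s x / 2)))%:E)%E.
Proof.
move=> gY m1 m2 mA; have [s1 s2 rho1 SE] := gaussian2_parameters gY.
have det0 := gaussian2_det_gt0 gY.
have [_ /(_ _ mA)] := gY; rewrite /distribution/= /pushforward => ->.
rewrite -ge0_integralZl//=; last 2 first.
- exact: measurable_expR_gform.
- by rewrite lee_fin invr_ge0 !mulr_ge0 ?pi_ge0 ?sqrtr_ge0.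
apply: eq_integral => x _; rewrite -EFinM /gaussian2_pdf /meanvec m1 m2/=.
have -> : colvec x - colvec (0, 0) = colvec x.
  by apply/matrixP => i j; rewrite !mxE/= if_same subr0.
by rewrite (inv_quad_form_gform _ rho1 s1 s2 SE) mulrC.
Qed.

End gaussian_law.

(** * Component-wise maxima and their indices in terms of hits *)

Section maxima.
Context {R : realType}.
Implicit Types (Y : nat -> R).

(** For [n > 0] the initial value [Y 0] of the iterated maximum is itself one of the candidates. *)
Lemma max_upto_gtP Y n (t : R) : (0 < n)%N ->
  t < max_upto Y n <-> exists2 i, (i < n)%N & t < Y i.
Proof.
move=> n0; split => [|[i iN tY]].
  apply: contraPP => /forallPNP H; apply/negP; rewrite -leNgt.
  apply/bigmax_leP; split; first by rewrite leNgt; apply/negP; exact: H.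
  by move=> i _; rewrite leNgt; apply/negP; exact: H.
apply: (lt_le_trans tY).
exact: (le_bigmax_cond (j := Ordinal iN) _ (fun i : 'I_n => Y i)).
Qed.

End maxima.

Section maximizers.
Context {d : measure_display} {T : measurableType d} {R : realType}.
Variables (P : probability T R) (X : nat -> {RV P >-> (R * R)%type}).

Lemma exceedance_hits (u : R * R) n : (0 < n)%N ->
  exceedance X u n =
  hits X (iota 0 n) [set x | a_ n * u.1 < x.1] `&`
  hits X (iota 0 n) [set x | a_ n * u.2 < x.2].
Proof.
move=> n0; apply/seteqP; split => w; rewrite /exceedance /vgt /Xbar/=.
  move=> /andP[/(max_upto_gtP _ _ n0)[i iN ti] /(max_upto_gtP _ _ n0)[j jN tj]].
  by split; [exists i|exists j] => //=; rewrite mem_iota.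
move=> [[i /=] + ti [j /=] + tj]; rewrite !mem_iota => iN jN.
by apply/andP; split; apply/max_upto_gtP => //; [exists i|exists j].
Qed.

(** On the exceedance event each maximizing index is itself a hit, so distinct maximizers fall under
    the union bound over pairs. *)
Lemma exceedance_distinct (u : R * R) n w (i j : nat) : exceedance X u n w ->
  attains_max (fun i => (X i w).1) n i -> attains_max (fun i => (X i w).2) n j ->
  i != j -> distinct_hits X n [set x | a_ n * u.1 < x.1] [set x | a_ n * u.2 < x.2] w.
Proof.
rewrite /exceedance /vgt /Xbar/= => /andP[t1 t2] [iN im] [jN jm] ij.
by exists i => //; exists j => //; rewrite (negbTE ij); split => /=; rewrite ?im ?jm.
Qed.

Lemma exceedance_common (u : R * R) n w (i : nat) : exceedance X u n w ->
  attains_max (fun i => (X i w).1) n i -> attains_max (fun i => (X i w).2) n i ->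
  hits X (iota 0 n) ([set x | a_ n * u.1 < x.1] `&` [set x | a_ n * u.2 < x.2]) w.
Proof.
rewrite /exceedance /vgt /Xbar/= => /andP[t1 t2] [iN im] [_ jm].
by exists i => /=; [rewrite mem_iota|split => /=; rewrite ?im ?jm].
Qed.

Lemma measurable_neq_RV (I J : {RV P >-> nat}) : measurable [set w | I w != J w].
Proof.
have -> : [set w | I w != J w] =
    \bigcup_k (I @^-1` [set k] `&` J @^-1` (~` [set k])).
  apply/seteqP; split => w /=.
    by move=> /eqP IJ; exists (I w) => //; split => //= E; apply: IJ.
  by move=> [k _ [/= <- Jk]]; apply/eqP => E; apply: Jk.
apply: bigcup_measurable => k _; apply: measurableI;
  by rewrite -[X in measurable X]setTI; exact: measurable_funP.
Qed.

End maximizers.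

(** * Rates of Gaussian half-plane and orthant probabilities *)

Section orthant_rates.
Context {d : measure_display} {T : measurableType d} {R : realType}.
Variables (P : probability T R) (Y : {RV P >-> (R * R)%type}).
Hypothesis gY : nondegenerate_gaussian2 Y.
Hypotheses (m1 : ('E_P[fst \o Y] = 0)%E) (m2 : ('E_P[snd \o Y] = 0)%E).
Let s := (stdev P (fst \o Y), stdev P (snd \o Y)).
Let rho := correlation P (fst \o Y) (snd \o Y).
Variable u : R * R.
Hypotheses (u1_gt0 : 0 < u.1) (u2_gt0 : 0 < u.2).
Let v := (u.1 / s.1, u.2 / s.2).
Let U n : set (R * R) := [set x | a_ n * u.1 < x.1].
Let V n : set (R * R) := [set x | a_ n * u.2 < x.2].

Lemma measurable_gt_fst (t : R) : measurable [set x : R * R | t < x.1].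
Proof.
have -> : [set x : R * R | t < x.1] = fst @^-1` `]t, +oo[.
  by apply/seteqP; split => x /=; rewrite in_itv/= andbT.
by rewrite -[X in measurable X]setTI; exact: measurable_fst.
Qed.

Lemma measurable_gt_snd (t : R) : measurable [set x : R * R | t < x.2].
Proof.
have -> : [set x : R * R | t < x.2] = snd @^-1` `]t, +oo[.
  by apply/seteqP; split => x /=; rewrite in_itv/= andbT.
by rewrite -[X in measurable X]setTI; exact: measurable_snd.
Qed.

Lemma log_rate_gaussian2 (A : nat -> set (R * R)) y : 0 < gform rho s y ->
  (forall n, measurable (A n)) ->
  (forall n x, A n x -> (@a_ R n) ^+ 2 * gform rho s y <= gform rho s x) ->
  (forall n x, vgt x (a_ n * y.1, a_ n * y.2) -> A n x) ->
  log_rate (fun n => fine (P (Y @^-1` A n))) (- (gform rho s y / 2)).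
Proof.
move=> y0 mA Age Asub; have [s1 s2 rho1 _] := gaussian2_parameters gY.
pose c := (2 * pi * Num.sqrt (\det (covmx P Y)))^-1.
have c0 : 0 < c.
  by rewrite invr_gt0 !mulr_gt0 ?pi_gt0// sqrtr_gt0 gaussian2_det_gt0.
apply: (log_rate_gform rho1 s1 s2 c0 y0 mA Age Asub) => n.
rewrite fine_probK ?(gaussian2_law gY m1 m2)//.
by rewrite -[X in measurable X]setTI; exact: measurable_funP.
Qed.

Lemma log_rate_gt_fst :
  log_rate (fun n => fine (P (Y @^-1` U n))) (- (v.1 ^+ 2 / 2)).
Proof.
have [s1 s2 rho1 _] := gaussian2_parameters gY.
have v1 : 0 < v.1 by rewrite divr_gt0.
(* The minimizer of the form on the line [x.1 = u.1]; its second coordinate is the conditional mean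
   given the first. *)
pose y := (u.1, rho * v.1 * s.2).
have yE : gform rho s y = v.1 ^+ 2.
  by rewrite /gform/= mulfK ?gt_eqF// mahal_axis1.
rewrite -yE; apply: log_rate_gaussian2 => [|n|n x Ux|n x].
- by rewrite yE exprn_gt0.
- exact: measurable_gt_fst.
- rewrite yE -exprMn.
  apply: (le_trans _ (mahal_ge1 _ rho1)); rewrite ler_sqr ?nnegrE/=.
  + by rewrite mulrA ler_pM2r ?invr_gt0// ltW.
  + by rewrite mulr_ge0 ?sqrtr_ge0// ltW.
  + rewrite divr_ge0 ?(ltW s1)// (le_trans _ (ltW Ux))//.
    by rewrite mulr_ge0 ?sqrtr_ge0// ltW.
- by move=> /andP[].
Qed.

Lemma log_rate_gt_snd :
  log_rate (fun n => fine (P (Y @^-1` V n))) (- (v.2 ^+ 2 / 2)).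
Proof.
have [s1 s2 rho1 _] := gaussian2_parameters gY.
have v2 : 0 < v.2 by rewrite divr_gt0.
pose y := (rho * v.2 * s.1, u.2).
have yE : gform rho s y = v.2 ^+ 2.
  by rewrite /gform/= mulfK ?gt_eqF// mahal_axis2.
rewrite -yE; apply: log_rate_gaussian2 => [|n|n x Vx|n x].
- by rewrite yE exprn_gt0.
- exact: measurable_gt_snd.
- rewrite yE -exprMn.
  apply: (le_trans _ (mahal_ge2 _ rho1)); rewrite ler_sqr ?nnegrE/=.
  + by rewrite mulrA ler_pM2r ?invr_gt0// ltW.
  + by rewrite mulr_ge0 ?sqrtr_ge0// ltW.
  + rewrite divr_ge0 ?(ltW s2)// (le_trans _ (ltW Vx))//.
    by rewrite mulr_ge0 ?sqrtr_ge0// ltW.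
- by move=> /andP[].
Qed.

Let m := mahal_argmin rho v.
(** The minimizer brought back from standardized to original coordinates. *)
Let y := (m.1 * s.1, m.2 * s.2).

Lemma gform_corner : gform rho s y = mahal rho m.
Proof.
have [s1 s2 _ _] := gaussian2_parameters gY.
by rewrite /gform/= !mulfK ?gt_eqF// -surjective_pairing.
Qed.

Lemma corner_ge : u.1 <= y.1 /\ u.2 <= y.2.
Proof.
have [s1 s2 _ _] := gaussian2_parameters gY.
by have [h1 h2] := mahal_argmin_ge rho v; split; rewrite -ler_pdivrMr.
Qed.

Lemma gform_corner_min x : u.1 <= x.1 -> u.2 <= x.2 ->
  gform rho s y <= gform rho s x.
Proof.
have [s1 s2 rho1 _] := gaussian2_parameters gY.
move=> x1 x2; rewrite gform_corner; apply: mahal_argminP => //=.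
- by rewrite divr_ge0 ?ltW.
- by rewrite divr_ge0 ?ltW.
- by rewrite ler_pM2r ?invr_gt0.
- by rewrite ler_pM2r ?invr_gt0.
Qed.

Lemma gform_corner_gt : v.1 ^+ 2 <= gform rho s y.
Proof.
have [s1 s2 rho1 _] := gaussian2_parameters gY.
rewrite gform_corner (le_trans _ (mahal_ge1 _ rho1))//.
have v1 : 0 <= v.1 by rewrite divr_ge0 ?ltW.
have [h1 _] := mahal_argmin_ge rho v.
by rewrite ler_sqr ?nnegrE// (le_trans v1).
Qed.

Lemma log_rate_orthant :
  log_rate (fun n => fine (P (Y @^-1` (U n `&` V n)))) (- (gform rho s y / 2)).
Proof.
have [s1 s2 rho1 _] := gaussian2_parameters gY.
have y_gt0 : 0 < gform rho s y.
  by apply: lt_le_trans gform_corner_gt; rewrite exprn_gt0// divr_gt0.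
apply: log_rate_gaussian2 => [//|n|n x [/= Ux Vx]|n x /andP[/= x1 x2]].
- by apply: measurableI; [exact: measurable_gt_fst|exact: measurable_gt_snd].
- have : 0 <= (@a_ R n) := sqrtr_ge0 _.
  (* Rescaling divides by [a_ n], so [a_ n = 0] is treated apart; there the bound is nonnegativity
     of the form. *)
  rewrite le_eqVlt => /predU1P[a0|a0].
    rewrite -a0 expr0n/= mul0r.
    exact: le_trans (sqr_ge0 _) (mahal_ge1 _ rho1).
  have -> : x =
      (a_ n * (x.1 / a_ n, x.2 / a_ n).1, a_ n * (x.1 / a_ n, x.2 / a_ n).2).
    by rewrite /= !(mulrC (a_ n)) !divfK ?gt_eqF// -surjective_pairing.
  rewrite gform_scale ler_pM2l ?exprn_gt0// gform_corner_min//=.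
  + by rewrite ler_pdivlMr// mulrC ltW.
  + by rewrite ler_pdivlMr// mulrC ltW.
- have [h1 h2] := corner_ge; split; rewrite /U /V/=.
  + by apply: le_lt_trans x1; rewrite ler_wpM2l// sqrtr_ge0.
  + by apply: le_lt_trans x2; rewrite ler_wpM2l// sqrtr_ge0.
Qed.

(** The same corner governs the orthant probability, so [J1] is the exponent of [n] times that
    probability. *)
Lemma J1_corner : J1 (covmx P Y) u = (1 - gform rho s y / 2)%:E.
Proof.
have [s1 s2 rho1 SE] := gaussian2_parameters gY.
rewrite /J1; under [X in ess_inf_on _ X]eq_fun do
  rewrite (inv_quad_form_gform _ rho1 s1 s2 SE).
rewrite (@ess_inf_on_gform _ _ _ _ y).
- by rewrite -EFinM -EFinB mulrC.
- move=> x /andP[x1 x2]; have [h1 h2] := corner_ge.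
  by rewrite /= /vgt (le_lt_trans h1 x1) (le_lt_trans h2 x2).
- by move=> x /andP[x1 x2]; apply: gform_corner_min; exact: ltW.
Qed.

End orthant_rates.

(** * Rate of the exceedance probability and conditional limits for the maximizing indices *)

Theorem mainTheorem1 (R : realType) (d : measure_display) (T : measurableType d)
    (P : probability T R) (X : nat -> {RV P >-> (R * R)%type})
    (Xindep : mutually_independent X) (Xident : identically_distributed X)
    (Xgauss : nondegenerate_gaussian2 (X 0%N))
    (Xmean1 : ('E_P[fst \o X 0%N] = 0)%E) (Xmean2 : ('E_P[snd \o X 0%N] = 0)%E)
    (Sigma : 'M[R]_2) (SigmaE : Sigma = covmx P (X 0%N))
    (sigma : R * R)
    (sigmaE : sigma = (stdev P (fst \o X 0%N), stdev P (snd \o X 0%N)))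
    (rho : R) (rhoE : rho = correlation P (fst \o X 0%N) (snd \o X 0%N))
    (u : R * R)
    (hu1 : Num.sqrt 2 * sigma.1 < u.1) (hu2 : Num.sqrt 2 * sigma.2 < u.2)
    (v : R * R) (vE : v = (u.1 / sigma.1, u.2 / sigma.2)) :
  (((a_ n ^+ 2)^-1 * ln (fine (P (exceedance X u n)))) @[n --> \oo]
     --> Jrate rho v)
  /\
  (forall Istar Jstar : nat -> {RV P >-> nat},
    (forall n w, (0 < n)%N ->
       attains_max (fun i => (X i w).1) n (Istar n w) /\
       attains_max (fun i => (X i w).2) n (Jstar n w)) ->
    ((J1 Sigma u < (2 - sqnorm2 v / 2)%:E)%E ->
       cond_prob P [set w | Istar n w != Jstar n w] (exceedance X u n)
         @[n --> \oo] --> (1 : R)) /\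
    (((2 - sqnorm2 v / 2)%:E < J1 Sigma u)%E ->
       cond_prob P [set w | Istar n w != Jstar n w] (exceedance X u n)
         @[n --> \oo] --> (0 : R))).
Proof.
have := gaussian2_parameters Xgauss; rewrite -sigmaE -rhoE => -[s1 s2 rho1 _].
have sqrt2 : 0 < Num.sqrt (2 : R) by rewrite sqrtr_gt0.
have u1_gt0 : 0 < u.1 by apply: le_lt_trans hu1; rewrite mulr_ge0// ltW.
have u2_gt0 : 0 < u.2 by apply: le_lt_trans hu2; rewrite mulr_ge0// ltW.
have sqr_gt2 (t : R) : Num.sqrt 2 < t -> 2 < t ^+ 2.
  move=> ht; rewrite -[ltLHS](@sqr_sqrtr R)// ltr_sqr ?nnegrE ?sqrtr_ge0//.
  by rewrite ltW// (lt_trans sqrt2).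
have v1 : 2 < v.1 ^+ 2 by apply: sqr_gt2; rewrite vE/= ltr_pdivlMr.
have v2 : 2 < v.2 ^+ 2 by apply: sqr_gt2; rewrite vE/= ltr_pdivlMr.
pose m := mahal_argmin rho v.
pose U n : set (R * R) := [set x | a_ n * u.1 < x.1].
pose V n : set (R * R) := [set x | a_ n * u.2 < x.2].
have mU n : measurable (U n) := measurable_gt_fst _.
have mV n : measurable (V n) := measurable_gt_snd _.
have mUV n : measurable (U n `&` V n) by exact: measurableI.
pose p1 n := fine (P (X 0%N @^-1` U n)).
pose p2 n := fine (P (X 0%N @^-1` V n)).
pose p12 n := fine (P (X 0%N @^-1` (U n `&` V n))).
have R1 : log_rate p1 (- (v.1 ^+ 2 / 2)).
  by have := log_rate_gt_fst Xgauss Xmean1 Xmean2 u1_gt0; rewrite -sigmaE -vE.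
have R2 : log_rate p2 (- (v.2 ^+ 2 / 2)).
  by have := log_rate_gt_snd Xgauss Xmean1 Xmean2 u2_gt0; rewrite -sigmaE -vE.
have R12 : log_rate p12 (- (mahal rho m / 2)).
  have := log_rate_orthant Xgauss Xmean1 Xmean2 u1_gt0 u2_gt0.
  by rewrite (gform_corner Xgauss) -sigmaE -rhoE -vE.
have JE : J1 Sigma u = (1 - mahal rho m / 2)%:E.
  rewrite SigmaE (J1_corner Xgauss u1_gt0 u2_gt0) (gform_corner Xgauss).
  by rewrite -sigmaE -rhoE -vE.
have mahal_m : v.1 ^+ 2 <= mahal rho m.
  have := gform_corner_gt Xgauss u1_gt0.
  by rewrite (gform_corner Xgauss) -sigmaE -rhoE -vE.
pose E n := exceedance X u n.
have EE n : (0 < n)%N -> E n = hits X (iota 0 n) (U n) `&` hits X (iota 0 n) (V n).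
  exact: exceedance_hits.
have mE n : (0 < n)%N -> measurable (E n).
  by move=> n0; rewrite EE//; apply: measurableI; exact: measurable_hits.
have pb (A : set (R * R)) : measurable A -> 0 <= fine (P (X 0%N @^-1` A)) <= 1.
  by move=> mA; apply: fine_prob_bound; exact: measurable_preimage_RV.
have bnd n := fine_prob_hitsI_bounds Xindep Xident n (mU n) (mV n).
have RE : log_rate (fun n => fine (P (E n)))
    (Num.max (2 - sqnorm2 v / 2) (1 - mahal rho m / 2)).
  have -> : 2 - sqnorm2 v / 2 = 2 + - (v.1 ^+ 2 / 2) + - (v.2 ^+ 2 / 2).
    by rewrite /sqnorm2; field.
  (* All three rates are below -1, since [v.1 ^+ 2] and [v.2 ^+ 2] exceed 2 and [mahal rho m] is at
     least [v.1 ^+ 2]. *)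
  apply: (log_rate_exceedance R1 R2 R12); [lra|lra|lra|..].
  - by move=> n; exact: pb.
  - by move=> n; exact: pb.
  - by move=> n; exact: pb.
  - by near=> n; rewrite EE; [case: (bnd n)|near: n; exact: nbhs_infty_gt].
  - by near=> n; rewrite EE; [case: (bnd n)|near: n; exact: nbhs_infty_gt].
  - by near=> n; rewrite EE; [case: (bnd n)|near: n; exact: nbhs_infty_gt].
split; first by case: RE => _; rewrite JrateE// ltW.
move=> I J IJ; rewrite JE !lte_fin.
have mIJ n : measurable [set w | I n w != J n w] by exact: measurable_neq_RV.
split => lt.
(* Equal maximizers yield a common hit, of probability at most [n * p12], whose exponent is here
   strictly below that of [E n]. *)
- have H : fine (P (E n `\` [set w | I n w != J n w])) / fine (P (E n))
      @[n --> \oo] --> 0.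
    apply: (log_rate_ratio_cvg0 (log_rateM (@log_rate_nat R) R12) RE).
      by rewrite lt_max lt.
    near=> n; have n0 : (0 < n)%N by near: n; exact: nbhs_infty_gt.
    rewrite fine_prob_ge0/=.
    apply: le_trans (fine_prob_hits_le Xident n (mUV n)).
    apply: fine_prob_le.
    + by apply: measurableD => //; exact: mE.
    + exact: measurable_hits.
    + move=> w [Ew /= /negP/negPn/eqP IJw]; have [Iw Jw] := IJ n w n0.
      by apply: (exceedance_common Ew Iw); rewrite IJw.
  have H1 : 1 - fine (P (E n `\` [set w | I n w != J n w])) / fine (P (E n))
      @[n --> \oo] --> (1 : R).
    by rewrite -[X in _ --> X](subr0 1); apply: cvgB => //; exact: cvg_cst.
  apply: cvg_trans H1; apply: near_eq_cvg; case: RE => E0 _.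
  near=> n; have n0 : (0 < n)%N by near: n; exact: nbhs_infty_gt.
  have En0 : 0 < fine (P (E n)) by near: n.
  rewrite /cond_prob -/(E n) setIC /=.
  have := fine_prob_setDI P (mE n n0) (mIJ n).
  move=> /(congr1 (fun t => t / fine (P (E n)))).
  rewrite divff ?gt_eqF// mulrDl => h; rewrite [X in X - _]h.
  by rewrite addrAC subrr add0r.
(* Distinct maximizers have probability at most [(n * p1) * (n * p2)], whose exponent is now the
   strictly smaller one. *)
- have N := @log_rate_nat R.
  have RD := log_rateM (log_rateM N R1) (log_rateM N R2).
  apply: (log_rate_ratio_cvg0 RD RE).
    have -> : 1 + - (v.1 ^+ 2 / 2) + (1 + - (v.2 ^+ 2 / 2)) = 2 - sqnorm2 v / 2.
      by rewrite /sqnorm2; field.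
    by rewrite lt_max lt orbT.
  near=> n; have n0 : (0 < n)%N by near: n; exact: nbhs_infty_gt.
  rewrite fine_prob_ge0/=.
  apply: le_trans (fine_prob_distinct_hits Xindep Xident n (mU n) (mV n)).
  apply: fine_prob_le.
  + by apply: measurableI => //; exact: mE.
  + exact: measurable_distinct_hits.
  + move=> w [/= IJw Ew]; have [Iw Jw] := IJ n w n0.
    exact: (exceedance_distinct Ew Iw Jw).
Unshelve. all: by end_near. Qed.
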